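(* Let $1<p<2$, $\lambda>0$, and let $q$ be defined by $\frac1p+\frac1q=1$. Let $\mu\in\mathcal{M}(\mathbb{R})$ be the measure with $S(\mu)=(0,\infty)$ and $$\ell_\mu(s)=\lambda\,\frac{(p-1)^{-\beta}}{2-p}\,\frac{1}{s^{\beta}},\quad s>0,\qquad \beta=\frac{2-p}{p-1},$$ which generates the exponential family with variance function $V_{F(\mu)}(m)=\frac{m^p}{\lambda^{p-1}}$ on $M_{F(\mu)}=(0,\infty)$. Then there exists a dual measure $\mu^*$ of $\mu$, and it generates the exponential family with variance function $$V_{F(\mu^* )}(s)=\Big(\frac pq\Big)^q\,\frac1\lambda\,s^q,\qquad s>0 .$$
   Context: For a positive measure $\mu$ on $\mathbb{R}$ let $B_\mu(s)=\int_{\mathbb{R}}e^{-sx}\mu(dx)$, let $S(\mu)$ be the interior of $\{s: B_\mu(s)<\infty\}$, and $\ell_\mu=\log B_\mu$. $\mathcal{M}(\mathbb{R})$ is the set of positive (possibly unbounded) measures on $\mathbb{R}$ not concentrated on one point and with $S(\mu)\neq\emptyset$. The natural exponential family generated by $\mu$ is $F(\mu)=\{e^{-sx-\ell_\mu(s)}\mu(dx): s\in S(\mu)\}$; the mean of the member indexed by $s$ is $m=-\ell'_\mu(s)$; $M_{F(\mu)}=-\ell'_\mu(S(\mu))$ is the domain of the means; with $\varphi_\mu:M_{F(\mu)}\to S(\mu)$ the inverse of $s\mapsto-\ell'_\mu(s)$, the variance function is $V_{F(\mu)}(m)=\ell''_\mu(\varphi_\mu(m))$. A measure $\mu^*\in\mathcal{M}(\mathbb{R})$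 is a dual measure of $\mu$ if $M_{F(\mu)}\subset S(\mu^* )$ and $-\ell'_{\mu^*}(-\ell'_\mu(s))=s$ for all $s\in S(\mu)$ (unique up to a positive multiplicative constant). *)

(* Defs.v *)
From HB Require Import structures.
From mathcomp Require Import all_boot all_order all_algebra.
From mathcomp Require Import all_classical all_reals all_analysis.

Set Implicit Arguments.
Unset Strict Implicit.
Unset Printing Implicit Defensive.

Import Order.TTheory GRing.Theory Num.Theory.
Import numFieldNormedType.Exports.

Local Open Scope classical_set_scope.
Local Open Scope ring_scope.

(* No finiteness is assumed: these are all positive Borel measures on R. *)
Definition borel_measure (R : realType) : Type :=
  {measure set (measurableTypeR R) -> \bar R}.

(* Takes the value +oo where the integral diverges. *)
Definition laplace (R : realType) (mu : borel_measure R) (s : R) : \bar R :=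
  (\int[mu]_(x in [set: measurableTypeR R]) (expR (- (s * x)))%:E)%E.

Definition laplace_dom (R : realType) (mu : borel_measure R) : set R :=
  interior [set s : R | (laplace mu s < +oo)%E].

(* Meaningful only where laplace mu s is finite. It is only used on
   laplace_dom mu, which is open, so that its derivatives at a point of that
   set involve no other values. *)
Definition log_laplace (R : realType) (mu : borel_measure R) (s : R) : R :=
  ln (fine (laplace mu s)).

(* The zero measure is excluded by the first conjunct. *)
Definition generating_measure (R : realType) (mu : borel_measure R) : Prop :=
  (~ exists a : R, mu (~` [set a]) = 0%E) /\ laplace_dom mu !=set0.

(* The mean of the member exp(-sx - log_laplace mu s) mu(dx) of
   the exponential family generated by mu. *)
Definition nef_mean (R : realType) (mu : borel_measure R) (s : R) : R :=
  - derive1 (log_laplace mu) s.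

Definition mean_dom (R : realType) (mu : borel_measure R) : set R :=
  nef_mean mu @` laplace_dom mu.

(* The default value 0 is taken only outside mean_dom mu. *)
Definition mean_inv (R : realType) (mu : borel_measure R) : R -> R :=
  'pinv_(fun=> 0) (laplace_dom mu) (nef_mean mu).

(* Meaningful on mean_dom mu only. *)
Definition variance_fun (R : realType) (mu : borel_measure R) (m : R) : R :=
  derive1n 2 (log_laplace mu) (mean_inv mu m).

Definition dual_measure (R : realType) (mu mu_star : borel_measure R) : Prop :=
  [/\ generating_measure mu_star,
      mean_dom mu `<=` laplace_dom mu_star &
      forall s, laplace_dom mu s -> nef_mean mu_star (nef_mean mu s) = s].

(* Main.v *)
Require Import Defs.
From HB Require Import structures.
From mathcomp Require Import all_boot all_order all_algebra.
From mathcomp Require Import all_classical all_reals all_analysis.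
From mathcomp Require Import measurable_realfun ring lra.

Set Implicit Arguments.
Unset Strict Implicit.
Unset Printing Implicit Defensive.

Import Order.TTheory GRing.Theory Num.Theory.
Import numFieldNormedType.Exports.

Local Open Scope classical_set_scope.
Local Open Scope ring_scope.

(** Write [r = p - 1], a number in (0, 1).  The mean of the family of [mu] is
    [A * s `^ (- r^-1)], with [A = lambda * r `^ (- r^-1)], so a dual measure
    must have mean [A `^ r * m `^ (- r)] at [m].  Every family on (0, oo) whose
    mean is a power has a power as variance function ([power_mean_variance]),
    and this gives both variance formulas once two points are settled.

    Existence of the dual.  Integrating the mean, the Laplace transform of a
    dual measure must be [expR (- (k * s `^ (1 - r)))] up to a factor: the
    dual is the one-sided stable law of index [a = 1 - r].  That this function
    is a Laplace transform ([exists_stable_measure]) is shown by a limit of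
    sums of independent heavy-tailed variables.  Let [X_n] have the Frechet
    distribution function [expR (- (c / 2 ^+ n * t `^ (- a)))] and let [mu_n]
    be the law of the sum of 2 ^ n independent copies of [X_n].
    - Frechet laws are max-stable: the maximum of two independent copies of
      [X_n.+1] has the law of [X_n].  The variables are positive, so a sum of
      two dominates their maximum, and [mu_n] increases stochastically.  The
      distribution functions thus decrease pointwise to a limit, which is the
      distribution function of a measure, with no compactness argument.
    - The layer cake formula [laplace_layer_cake] writes a Laplace transform
      as an integral of the distribution function, so dominated convergence
      carries pointwise convergence over to Laplace transforms
      ([st_le_cvg_laplace]).
    - By the same formula, 2 ^ n times one minus the Laplace transform of [X_n]
      tends to [c] times the integral of [s * expR (- (s * t)) * t `^ (- a)],
      which is proportional to [s `^ a] by scaling.  The 2 ^ n-th power of the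
      transform therefore tends to [expR (- (k * s `^ a))], and [c] is chosen
      to give the required [k].

    Domain of an arbitrary dual.  The dual relation prescribes the mean only
    on (0, oo).  The domain is open, so if it contained a point s <= 0, the
    Laplace transform of the dual would be finite at some negative point.  Its
    convexity would then make it Lipschitz on (0, 1), whereas its logarithmic
    derivative is unbounded at 0.  Hence the domain is (0, oo)
    ([power_mean_laplace_dom]). *)

(** * Exponentials and the layer cake formula *)

Lemma mem_set_eq (T : Type) (A : set T) (x : T) (b : bool) :
  (A x <-> b) -> (x \in A) = b.
Proof. by move=> Ab; apply/idP/idP => [/set_mem/Ab//|/Ab/mem_set]. Qed.

Lemma is_derive_expR_scale (R : realType) (s x : R) :
  is_derive x 1 (fun t : R => - expR (- (s * t))) (s * expR (- (s * x))).
Proof.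
have h : is_derive x 1 (fun t : R => expR (- (s * t))) (expR (- (s * x)) * - s).
  rewrite (_ : (fun t => expR _) = expR \o (fun t => - (s * t)))//.
  apply: is_derive1_comp.
  rewrite (_ : (fun t => - (s * t)) = - s *: (id : R -> R^o)); last first.
    by apply/funext => t; rewrite -mulNr.
  apply: is_derive_eq => /=. by rewrite [LHS]mulr1.
have := is_deriveN h; rewrite mulrN opprK mulrC; exact.
Qed.

Lemma continuous_expR_scale (R : realType) (s : R) :
  continuous (fun t : R => expR (- (s * t))).
Proof.
move=> x; apply: continuous_comp; last exact: continuous_expR.
by apply: cvgN; apply: cvgM; [exact: cvg_cst|exact: cvg_id].
Qed.

Lemma measurable_expR_scale (R : realType) (s : R) (D : set R) :
  measurable_fun D (fun t : R => expR (- (s * t))).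
Proof.
apply: measurable_funTS; apply: continuous_measurable_fun.
exact: continuous_expR_scale.
Qed.

Lemma integral_expR_tail (R : realType) (s a : R) : 0 < s ->
  (\int[lebesgue_measure]_(t in `[a, +oo[) (s * expR (- (s * t)))%:E)%E =
  (expR (- (s * a)))%:E.
Proof.
move=> s0.
rewrite (ge0_continuous_FTC2y (F := fun t => - expR (- (s * t))) (l := 0)).
- by rewrite -EFinB sub0r opprK.
- by move=> x _; rewrite mulr_ge0// ?expR_ge0// ltW.
- apply: continuous_subspaceT => x; apply: cvgM; first exact: cvg_cst.
  exact: continuous_expR_scale.
- rewrite -oppr0; apply: cvgN.
  apply: (cvg_comp _ _ _ (@cvgr_expR R)); exact: gt0_cvgMry.
- by move=> x _; have [] := is_derive_expR_scale s x.
- apply: cvg_at_right_filter; apply: cvgN; exact: continuous_expR_scale.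
- by move=> x _; rewrite derive1E; have [] := is_derive_expR_scale s x.
Qed.

(** The exponential at [x] is the integral of its derivative over t >= x, and
    Tonelli's theorem exchanges this integral with the one against [P]. *)
Lemma laplace_layer_cake (R : realType)
  (P : {sigma_finite_measure set (measurableTypeR R) -> \bar R}) (s : R) :
  0 < s -> (forall t, t <= 0 -> P `]-oo, t]%classic = 0%E) ->
  laplace P s =
  (\int[lebesgue_measure]_(t in `]0%R, +oo[)
     ((s * expR (- (s * t)))%:E * P `]-oo, t]%classic))%E.
Proof.
move=> s0 P0; rewrite /laplace.
pose g (z : measurableTypeR R * measurableTypeR R) :=
  ((s * expR (- (s * z.2)))%:E * (\1_[set z | z.1 <= z.2] z)%:E)%E.
have mset : measurable [set z : measurableTypeR R * measurableTypeR R | z.1 <= z.2].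
  have : measurable_fun setT
    (fun z : measurableTypeR R * measurableTypeR R => z.1 <= z.2).
    by apply: measurable_fun_ler.
  by move=> /(_ measurableT [set true]); rewrite setTI; exact.
have mg : measurable_fun setT g.
  apply: emeasurable_funM.
    apply/measurable_EFinP; apply: measurable_funM => //.
    apply: (measurableT_comp (f := fun t : R => expR (- (s * t))) (g := snd)).
      exact: measurable_expR_scale.
    exact: measurable_snd.
  by apply/measurable_EFinP; apply: (@measurable_indic _ _ _ setT _ mset).
have g0 z : (0 <= g z)%E.
  by rewrite mule_ge0// lee_fin// mulr_ge0// ?expR_ge0// ltW.
transitivity (\int[P]_x \int[lebesgue_measure]_t g (x, t))%E.
  apply: eq_integral => x _; rewrite -integral_expR_tail// integral_mkcond.
  apply: eq_integral => t _; rewrite /g patchE/= indicE.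
  rewrite !(@mem_set_eq _ _ _ (x <= t))//; last by rewrite /= in_itv/= andbT.
  by case: ifPn; rewrite ?mule1 ?mule0.
rewrite fubini_tonelli// [RHS]integral_mkcond.
apply: eq_integral => t _; rewrite /g patchE/=.
rewrite (@mem_set_eq _ _ _ (0 < t)); last by rewrite /= in_itv/= andbT.
have -> : (\int[P]_x ((s * expR (- (s * t)))%:E *
     (\1_[set z : R * R | (z.1 <= z.2)%R] (x, t))%:E) =
    (s * expR (- (s * t)))%:E * P `]-oo, t]%classic)%E.
  rewrite ge0_integralZl//; last 2 first.
  - apply/measurable_EFinP.
    exact: (measurable_fun_pair1 _ (measurable_indic mset)).
  - by rewrite lee_fin mulr_ge0// ?expR_ge0// ltW.
  congr (_ * _)%E.
  transitivity (\int[P]_x (\1_`]-oo, t] x)%:E)%E; last first.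
    by rewrite integral_indic// setIT.
  apply: eq_integral => x _; rewrite !indicE.
  by rewrite !(@mem_set_eq _ _ _ (x <= t))//= in_itv.
case: ifPn => //; rewrite -leNgt => t0; by rewrite P0// mule0.
Qed.


(** * Convolution *)

Section convolution.
Context {R : realType}.
Notation T := (measurableTypeR R).
Implicit Types P Q : probability T R.

Definition addition (z : T * T) : T := z.1 + z.2.

Let measurable_addition : measurable_fun setT addition.
Proof. exact: measurable_funD. Qed.

HB.instance Definition _ :=
  @isMeasurableFun.Build _ _ _ _ addition measurable_addition.

Definition convolve P Q : probability T R := distribution (P \x Q)%E addition.

Lemma laplace_convolve P Q s :
  laplace (convolve P Q) s = (laplace P s * laplace Q s)%E.
Proof.
rewrite /laplace /convolve ge0_integral_distribution//=; last first.
  by apply/measurable_EFinP; exact: measurable_expR_scale.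
rewrite fubini_tonelli1//; last first.
  apply/measurable_EFinP.
  apply: (measurableT_comp (f := fun t : R => expR (- (s * t)))) => //.
  exact: measurable_expR_scale.
rewrite -ge0_integralZr//; last 2 first.
- by apply/measurable_EFinP; exact: measurable_expR_scale.
- by apply: integral_ge0 => x _; rewrite lee_fin expR_ge0.
apply: eq_integral => x _; rewrite /fubini_F -ge0_integralZl//.
- by apply: eq_integral => y _; rewrite /addition/= mulrDr opprD expRD EFinM.
- by apply/measurable_EFinP; exact: measurable_expR_scale.
Qed.

Let convolve_cdf P Q z : convolve P Q `]-oo, z]%classic =
  (\int[P \x Q]_w (\1_(addition @^-1` `]-oo, z]) w)%:E)%E.
Proof.
by rewrite integral_indic ?setIT// -[X in measurable X]setTI;
  exact: measurable_addition.
Qed.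

Let m_addition z : measurable (addition @^-1` `]-oo, z]).
Proof. by rewrite -[X in measurable X]setTI; exact: measurable_addition. Qed.

Lemma convolve_cdfl P Q z : convolve P Q `]-oo, z]%classic =
  (\int[P]_x Q `]-oo, (z - x)%R]%classic)%E.
Proof.
rewrite convolve_cdf fubini_tonelli1//; last first.
  by apply/measurable_EFinP; exact: measurable_indic.
apply: eq_integral => x _; rewrite /fubini_F.
transitivity (\int[Q]_y (\1_`]-oo, (z - x)%R] y)%:E)%E; last first.
  by rewrite integral_indic// setIT.
apply: eq_integral => y _; rewrite !indicE.
by rewrite !(@mem_set_eq _ _ _ (x + y <= z))//= in_itv/= ?lerBrDl.
Qed.

Lemma convolve_cdfr P Q z : convolve P Q `]-oo, z]%classic =
  (\int[Q]_y P `]-oo, (z - y)%R]%classic)%E.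
Proof.
rewrite convolve_cdf fubini_tonelli2//; last first.
  by apply/measurable_EFinP; exact: measurable_indic.
apply: eq_integral => y _; rewrite /fubini_G.
transitivity (\int[P]_x (\1_`]-oo, (z - y)%R] x)%:E)%E; last first.
  by rewrite integral_indic// setIT.
apply: eq_integral => x _; rewrite !indicE.
by rewrite !(@mem_set_eq _ _ _ (x + y <= z))//= in_itv/= ?lerBrDr.
Qed.

Let idT : T -> R := idfun.

#[local] HB.instance Definition _ :=
  @isMeasurableFun.Build _ _ _ _ idT (@measurable_id _ _ setT).

Lemma measurable_cdf P : measurable_fun setT (fun x : R => P `]-oo, x]%classic).
Proof. exact: (cdf_measurable (idT : {RV P >-> R})). Qed.

Lemma right_continuous_cdf P x :
  P `]-oo, y]%classic @[y --> x^'+] --> P `]-oo, x]%classic.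
Proof. exact: (cdf_right_continuous (X := (idT : {RV P >-> R}))). Qed.

End convolution.


(** * Stochastic order *)

Section stochastic_order.
Context {R : realType}.
Notation T := (measurableTypeR R).
Implicit Types P Q : probability T R.

(** The usual stochastic order: [Q] is the larger law. *)
Definition st_le P Q :=
  forall x : R, (Q `]-oo, x]%classic <= P `]-oo, x]%classic)%E.

Let measurable_cdf_sub P z :
  measurable_fun setT (fun x : R => P `]-oo, (z - x)%R]%classic).
Proof.
apply: (measurableT_comp (measurable_cdf P)).
exact: measurable_funB.
Qed.

(** The distribution function of a convolution is an integral of either
    factor's distribution function, so the factors can be replaced one at a
    time. *)
Lemma st_le_convolve P P' Q Q' : st_le P P' -> st_le Q Q' ->
  st_le (convolve P Q) (convolve P' Q').
Proof.
move=> PP QQ z; apply: (@le_trans _ _ (convolve P' Q `]-oo, z]%classic)).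
  rewrite !convolve_cdfl; apply: ge0_le_integral => //.
  - exact: measurable_cdf_sub.
  - exact: measurable_cdf_sub.
rewrite !convolve_cdfr; apply: ge0_le_integral => //.
- exact: measurable_cdf_sub.
- exact: measurable_cdf_sub.
Qed.

Definition convolve_double n P := iter n (fun Q => convolve Q Q) P.

Lemma st_le_convolve_double n P Q : st_le P Q ->
  st_le (convolve_double n P) (convolve_double n Q).
Proof. by move=> PQ; elim: n => //= n IH; exact: st_le_convolve. Qed.

Lemma laplace_convolve_double n P s (r : R) : laplace P s = r%:E ->
  laplace (convolve_double n P) s = (r ^+ (2 ^ n))%:E.
Proof.
move=> Pr; elim: n => [|n IH]; first by rewrite expn0 expr1.
by rewrite /= laplace_convolve IH -EFinM -exprD addnn -mul2n expnS.
Qed.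

(** For a law carried by (0, oo), a sum of two independent variables is at
    least their maximum, whose distribution function is the square. *)
Lemma convolve_le_max P z : P `]-oo, 0%R]%classic = 0%E ->
  (convolve P P `]-oo, z]%classic <=
   P `]-oo, z]%classic * P `]-oo, z]%classic)%E.
Proof.
move=> P0; rewrite convolve_cdfl.
have -> : (P `]-oo, z]%classic * P `]-oo, z]%classic =
    \int[P]_x ((\1_`]-oo, z] x)%:E * P `]-oo, z]%classic))%E.
  rewrite ge0_integralZr//; first by rewrite integral_indic// setIT.
  by apply/measurable_EFinP; exact: measurable_indic.
apply: ae_ge0_le_integral => //.
- exact: measurable_cdf_sub.
- by move=> x _; rewrite mule_ge0.
- apply: emeasurable_funM => //.
  by apply/measurable_EFinP; exact: measurable_indic.
- exists `]-oo, 0%R]%classic; split => // x /= /not_implyP[_].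
  apply: contra_notP; rewrite in_itv/= => /negP; rewrite -ltNge => x0.
  rewrite indicE (@mem_set_eq _ _ _ (x <= z)) ?in_itv//.
  case: (leP x z) => xz.
    rewrite mul1e le_measure ?inE// => y/=; rewrite !in_itv/= => yx.
    by rewrite (le_trans yx)// lerBlDr lerDl ltW.
  rewrite mul0e -P0 le_measure ?inE// => y/=; rewrite !in_itv/= => yx.
  by rewrite (le_trans yx)// subr_le0 ltW.
Qed.

End stochastic_order.


(** * Distribution functions and monotone limits of laws *)

Section cdf_existence.
Context {R : realType}.
Notation T := (measurableTypeR R).

(** As [G] vanishes at negative points, ]- n, r] already has measure [G r] for
    large [n]. *)
Lemma lebesgue_stieltjes_measure_ray (G : cumulative R R) r :
  (forall t, t <= 0 -> G t = 0) ->
  lebesgue_stieltjes_measure G `]-oo, r]%classic = (G r)%:E.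
Proof.
move=> G0; rewrite itvNybndEbigcup.
have h1 : lebesgue_stieltjes_measure G `]-n%:R, r] @[n --> \oo] --> (G r)%:E.
  apply: (@cvg_near_cst _ _ _ _ (fun n => _)); near=> n.
  rewrite /lebesgue_stieltjes_measure /measure_extension/=.
  rewrite measurable_mu_extE/= ?wlength_itv_bnd//; last exact: is_ocitv.
  - by rewrite /= (G0 (- n%:R)) ?subr0// oppr_le0.
  - by rewrite lerNl; near: n; exact: nbhs_infty_ger.
apply: cvg_unique h1 => //; apply: nondecreasing_cvg_mu => //.
  exact: bigcup_measurable.
by move=> *; apply/subsetPset/subset_itv; rewrite leBSide//= lerN2 ler_nat.
Unshelve. all: by end_near. Qed.

Lemma exists_measure_cdf (F : R -> R) :
  {homo F : x y / x <= y} -> right_continuous F -> (forall t, t <= 0 -> F t = 0) ->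
  exists P : {sigma_finite_measure set T -> \bar R},
    forall t : R, P `]-oo, t]%classic = (F t)%:E.
Proof.
move=> ndF rcF F0.
pose G : cumulative R R := HB.pack F (isCumulative.Build R _ R F ndF rcF).
exists (lebesgue_stieltjes_measure G) => r.
exact: lebesgue_stieltjes_measure_ray.
Qed.

Lemma exists_probability_cdf (F : R -> R) :
  {homo F : x y / x <= y} -> right_continuous F ->
  F @ -oo --> (0 : R) -> F @ +oo --> (1 : R) ->
  exists P : probability T R, forall t : R, P `]-oo, t]%classic = (F t)%:E.
Proof.
move=> ndF rcF F0 F1.
pose G : cumulativeBounded (0:R) (1:R) := HB.pack F
  (isCumulative.Build R _ R F ndF rcF)
  (isCumulativeBounded.Build R 0 1 F F0 F1).
exists (lebesgue_stieltjes_measure G) => r.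
exact: (cdf_lebesgue_stieltjes_id G r).
Qed.

(** The distribution functions decrease with [n]; an infimum of nondecreasing
    right-continuous functions is again nondecreasing and right-continuous,
    hence a distribution function.  The Laplace transforms follow by dominated
    convergence in the layer cake formula. *)
Lemma st_le_cvg_laplace (mu : nat -> probability T R) :
  mu 0%N `]-oo, 0%R]%classic = 0%E ->
  (forall n, st_le (mu n) (mu n.+1)) ->
  exists P : borel_measure R, forall s, 0 < s ->
    laplace (mu n) s @[n --> \oo] --> laplace P s.
Proof.
move=> mu0 mule.
pose f n t := fine (mu n `]-oo, t]%classic).
have fE n t : mu n `]-oo, t]%classic = (f n t)%:E by rewrite fineK// fin_num_measure.
have f_ge0 n t : 0 <= f n t by rewrite fine_ge0.
have f_le1 n t : f n t <= 1 by rewrite -lee_fin -fE probability_le1.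
have f_nd n : {homo f n : x y / x <= y}.
  move=> x y xy; rewrite -lee_fin -!fE le_measure ?inE//.
  by apply: subset_itvl; rewrite bnd_simp.
have f_ni t : nonincreasing_seq (f ^~ t).
  by apply/nonincreasing_seqP => n; rewrite -lee_fin -!fE; exact: mule.
have f_0 n t : t <= 0 -> f n t = 0.
  move=> t0; apply/eqP; rewrite eq_le f_ge0 andbT.
  apply: (@le_trans _ _ (f 0%N 0)); last by rewrite -lee_fin -fE mu0.
  by rewrite (le_trans (f_nd n _ _ t0))// f_ni.
have f_cvg t : cvgn (f ^~ t).
  by apply: nonincreasing_is_cvgn => //; exists 0 => _ [n _ <-]; exact: f_ge0.
pose F t := limn (f ^~ t).
have F_le n t : F t <= f n t by exact: nonincreasing_cvgn_ge.
have F_nd : {homo F : x y / x <= y}.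
  by move=> x y xy; apply: ler_lim => //; apply: nearW => n; exact: f_nd.
have F_rc : right_continuous F.
  move=> x; apply/cvgrPdist_le => /= e e0.
  have /cvgrPdist_lt/(_ (e / 2))[|N _ /(_ N (leqnn _))/= FN] := f_cvg x.
    by rewrite divr_gt0.
  have : f N y @[y --> x^'+] --> f N x.
    by apply: fine_cvg; rewrite -fE; exact: right_continuous_cdf.
  move=> /cvgrPdist_lt/(_ (e / 2))[|d d0 Hd]; first by rewrite divr_gt0.
  near=> y.
  have xy : x < y by near: y; exact: nbhs_right_gt.
  have : `|f N x - f N y| < e / 2 by near: y; exists d.
  have := F_le N x; have := F_le N y; have := F_nd _ _ (ltW xy).
  move: FN; rewrite -/(F x) !ltr_norml => /andP[a1 a2] b1 b2 b3 /andP[c1 c2].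
  rewrite ler_norml; lra.
have F_0 t : t <= 0 -> F t = 0.
  move=> t0; apply/eqP; rewrite eq_le -{1}(f_0 0%N _ t0) F_le/=.
  by apply: limr_ge => //; apply: nearW => n.
have [P PF] := exists_measure_cdf F_nd F_rc F_0.
exists P => s s0.
rewrite laplace_layer_cake//; last by move=> t t0; rewrite PF F_0.
have mg : measurable_fun setT (fun t : R => (s * expR (- (s * t)))%:E).
  apply/measurable_EFinP; apply: measurable_funM => //.
  exact: measurable_expR_scale.
have -> : (fun n => laplace (mu n) s) = fun n =>
    (\int[lebesgue_measure]_(t in `]0%R, +oo[)
     ((s * expR (- (s * t)))%:E * (f n t)%:E))%E.
  apply/funext => n; rewrite laplace_layer_cake//.
    by apply: eq_integral => t _; rewrite -fE.
  by move=> t t0; have := fE n t; rewrite f_0.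
apply: (@dominated_cvg _ _ _ lebesgue_measure _ _
  (fun n t => (s * expR (- (s * t)))%:E * (f n t)%:E)%E
  (fun t => (s * expR (- (s * t)))%:E * P `]-oo, t]%classic)%E
  (fun t => (s * expR (- (s * t)))%:E)) => //.
- move=> n; apply: emeasurable_funM.
    exact: measurable_funTS.
  apply: measurable_funTS.
  apply: (eq_measurable_fun (fun t : R => mu n `]-oo, t]%classic)).
    by move=> t _; rewrite -fE.
  exact: measurable_cdf.
- move=> t t0; rewrite PF -EFinM; under eq_fun do rewrite -EFinM.
  by apply: cvg_EFin; [exact: nearW|apply: cvgM; [exact: cvg_cst|exact: f_cvg]].
- apply/integrableP; split.
    exact: measurable_funTS.
  rewrite integral_itv_obnd_cbnd; last first.
    by apply: measurableT_comp => //; exact: measurable_funTS.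
  under eq_integral do rewrite gee0_abs ?lee_fin ?mulr_ge0 ?expR_ge0 ?(ltW s0)//.
  by rewrite integral_expR_tail// ltry.
- move=> n t _; rewrite gee0_abs -?EFinM ?lee_fin ?mulr_ge0 ?expR_ge0 ?(ltW s0)//.
  by rewrite ler_piMr// mulr_ge0// ?expR_ge0 ?(ltW s0).
Unshelve. all: by end_near. Qed.

End cdf_existence.

(** * The integral of an exponential against a negative power *)

Lemma continuous_powR (R : realType) (r x : R) : 0 < x ->
  {for x, continuous (fun t : R => t `^ r)}.
Proof.
move=> x0; apply: differentiable_continuous; apply/derivable1_diffP.
by apply: derivable_powR; rewrite in_itv/= andbT.
Qed.

Section gamma_integral.
Context {R : realType}.
Local Notation leb := (@lebesgue_measure R).

(** Lebesgue measure is [r] times its image under multiplication by [r]; both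
    measures agree on half-open intervals. *)
Lemma integral_scale (r : R) (f : R -> \bar R) : 0 < r ->
  measurable_fun setT f -> (forall t, 0 <= f t)%E ->
  (\int[leb]_(t in `]0%R, +oo[) f t =
   \int[leb]_(t in `]0%R, +oo[) (r%:E * f (r * t)%R))%E.
Proof.
move=> r0 mf f0.
pose phi : measurableTypeR R -> measurableTypeR R := fun u => r * u.
have mphi : measurable_fun setT phi by exact: measurable_funM.
have r_ge0 : 0 <= r by exact: ltW.
pose k : {nonneg R} := NngNum r_ge0.
have scaleE (A : set R) : measurable A ->
    leb A = mscale k (pushforward leb phi) A.
  apply: lebesgue_measure_unique => _ [[a b]] _ <-.
  have e : phi @^-1` `]a, b]%classic = `](a / r), (b / r)]%classic.
    apply/seteqP; split => x /=; rewrite !in_itv/= /phi;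
      by rewrite ltr_pdivrMr// ler_pdivlMr// !(mulrC r).
  transitivity (r%:E * leb (phi @^-1` `]a, b]%classic))%E => //.
  rewrite e !lebesgue_measure_itv/= !lte_fin ltr_pM2r ?invr_gt0//.
  by case: ifPn => _; rewrite ?mule0// -!EFinD -EFinM -mulrBl mulrC divfK// gt_eqF.
rewrite (eq_measure_integral (mscale k (pushforward leb phi))); last first.
  by move=> A mA _; exact: scaleE.
rewrite ge0_integral_mscale//=; last exact: measurable_funTS.
rewrite ge0_integral_pushforward//; last exact: measurable_funTS.
rewrite (_ : phi @^-1` _ = `]0%R, +oo[%classic); last first.
  by apply/seteqP; split => x /=; rewrite !in_itv/= /phi !andbT pmulr_rgt0.
rewrite ge0_integralZl//.
apply: measurable_funTS; exact: measurableT_comp.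
Qed.

Variable a : R.
Hypothesis a01 : 0 < a < 1.
Let a_gt0 : 0 < a. Proof. by case/andP: a01. Qed.
Let a_lt1 : a < 1. Proof. by case/andP: a01. Qed.

(** This is Gamma(1 - a) * s `^ a. *)
Definition power_laplace (s : R) : \bar R :=
  (\int[leb]_(t in `]0%R, +oo[) (s * expR (- (s * t)) * t `^ (- a))%:E)%E.

Let measurable_weight s D :
  measurable_fun D (fun t : R => (s * expR (- (s * t)) * t `^ (- a))%:E).
Proof.
apply: measurable_funTS; apply/measurable_EFinP; apply: measurable_funM.
  by apply: measurable_funM => //; exact: measurable_expR_scale.
exact: measurable_powR.
Qed.

Lemma power_laplace_homogeneous s : 0 < s ->
  power_laplace s = ((s `^ a)%:E * power_laplace 1)%E.
Proof.
move=> s0; have s0' : 0 < s^-1 by rewrite invr_gt0.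
rewrite /power_laplace (integral_scale s0'); last 2 first.
- exact: measurable_weight.
- by move=> t; rewrite lee_fin !mulr_ge0 ?expR_ge0 ?powR_ge0 ?ltW.
rewrite -ge0_integralZl//; last 3 first.
- exact: measurable_weight.
- by move=> t _; rewrite lee_fin !mulr_ge0 ?expR_ge0 ?powR_ge0.
- by rewrite lee_fin powR_ge0.
apply: eq_integral => t; rewrite inE/= in_itv/= andbT => t0.
rewrite -!EFinM; congr EFin.
have s_neq0 : s != 0 by rewrite gt_eqF.
have -> : (s^-1 * t) `^ (- a) = s `^ a * t `^ (- a).
  by rewrite powRM ?invr_ge0 ?ltW// -powR_inv1 ?ltW// -powRrM mulN1r opprK.
by rewrite (mulrA s) divff// !mul1r; field.
Qed.

Lemma power_laplace1_gt0 : (0 < power_laplace 1)%E.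
Proof.
apply: (@lt_le_trans _ _ (\int[leb]_(t in `]0%R, 1%R]) (expR (- 1))%:E)%E).
  by rewrite integral_cst//= lebesgue_measure_itv/= lte_fin ltr01 oppr0 adde0
    mule1 lte_fin expR_gt0.
apply: (@le_trans _ _ (\int[leb]_(t in `]0%R, 1%R])
  (1 * expR (- (1 * t)) * t `^ (- a))%:E)%E).
  apply: ge0_le_integral => //.
  - exact: measurable_weight.
  - move=> t /=; rewrite in_itv/= => /andP[t0 t1].
    rewrite lee_fin !mul1r -[leLHS]mulr1 ler_pM ?expR_ge0//.
      by rewrite ler_expR lerN2.
    by rewrite powRN -[leLHS]invr1 lef_pV2 ?posrE ?powR_gt0//
      -(powRr0 t) ger_powR ?t0//= ltW.
apply: ge0_subset_integral => //.
- exact: measurable_weight.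
- by move=> t _; rewrite lee_fin !mulr_ge0 ?expR_ge0 ?powR_ge0.
- by apply: subset_itvl.
Qed.

(** On [1 / n.+2, 1] the power has the primitive [(1 - a)^-1 * t `^ (1 - a)],
    which gives a bound uniform in [n]; the intervals increase to ]0, 1]. *)
Lemma integral_powR_01 :
  (\int[leb]_(t in `]0%R, 1%R]) (t `^ (- a))%:E <= ((1 - a)^-1)%:E)%E.
Proof.
pose I n : set R := `[n.+2%:R^-1, 1%R]%classic.
have -> : `]0%R, 1%R]%classic = \bigcup_n I n.
  apply/seteqP; split => x /=.
    rewrite in_itv/= => /andP[x0 x1].
    exists (Num.truncn x^-1) => //; rewrite /I/= in_itv/= x1 andbT.
    rewrite invf_ple ?posrE//.
    have := truncnS_gt (x^-1). move=> /ltW /le_trans; apply. by rewrite ler_nat.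
  move=> [n _]; rewrite /I/= !in_itv/= => /andP[h ->]; rewrite andbT.
  by apply: lt_le_trans h; rewrite invr_gt0.
have mp D : measurable_fun D (fun t : R => (t `^ (- a))%:E).
  by apply: measurable_funTS; apply/measurable_EFinP; exact: measurable_powR.
have cvgI : (\int[leb]_(t in I n) (t `^ (- a))%:E)%E @[n --> \oo] -->
    (\int[leb]_(t in \bigcup_n I n) (t `^ (- a))%:E)%E.
  apply: ge0_nondecreasing_set_cvg_integral => //.
  - move=> n m nm; apply/subsetPset/subset_itvr; rewrite bnd_simp.
    by rewrite lef_pV2 ?posrE// ler_nat !ltnS.
  - by move=> i; exact: measurable_itv.
  - by move=> i; exact: mp.
  - by move=> i x _; rewrite lee_fin powR_ge0.
rewrite -(cvg_lim _ cvgI)//; apply: lime_le.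
  by apply/cvg_ex; eexists; exact: cvgI.
apply: nearW => n; rewrite /I.
have n1 : n.+2%:R^-1 < 1 :> R by rewrite invf_lt1// ltr1n.
have n0 : 0 < n.+2%:R^-1 :> R by rewrite invr_gt0.
have b_gt0 : 0 < 1 - a by rewrite subr_gt0.
have dF (x : R) : 0 < x ->
    is_derive x 1 (fun t : R => (1 - a)^-1 * t `^ (1 - a)) (x `^ (- a)).
  move=> x0; have := is_deriveZ (1 - a)^-1 (is_derive1_powR (1 - a) x0).
  rewrite /GRing.scale/= mulrA mulVf ?gt_eqF// mul1r.
  by rewrite (_ : 1 - a - 1 = - a)//; ring.
have cF (x : R) : 0 < x ->
    {for x, continuous (fun t : R => (1 - a)^-1 * t `^ (1 - a))}.
  by move=> x0; apply: cvgM; [exact: cvg_cst|exact: continuous_powR].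
rewrite (@continuous_FTC2 _ _ (fun t => (1 - a)^-1 * t `^ (1 - a)))//.
- rewrite -EFinB lee_fin powR1 mulr1 gerBl.
  by rewrite mulr_ge0// ?powR_ge0// invr_ge0 ltW.
- apply: continuous_in_subspaceT => x; rewrite inE/= in_itv/= => /andP[nx _].
  by apply: continuous_powR; rewrite (lt_le_trans n0).
- split.
  + move=> x; rewrite in_itv/= => /andP[nx _].
    by have [] := dF _ (lt_trans n0 nx).
  + by apply: cvg_at_right_filter; exact: cF.
  + by apply: cvg_at_left_filter; exact: cF.
- move=> x; rewrite in_itv/= => /andP[nx _].
  by rewrite derive1E; have [_] := dF _ (lt_trans n0 nx).
Qed.

Lemma power_laplace_lty s : 0 < s -> (power_laplace s < +oo)%E.
Proof.
move=> s0; rewrite power_laplace_homogeneous// lte_mul_pinfty ?lee_fin ?powR_ge0//.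
rewrite /power_laplace.
have -> : `]0%R, +oo[%classic = `]0%R, 1%R]%classic `|` `]1%R, +oo[%classic :> set R.
  apply/seteqP; split => x /=; rewrite !in_itv/= !andbT.
    by move=> x0; case: (leP x 1) => _; [left; rewrite x0|right].
  by move=> [/andP[]//|]; exact: lt_trans.
rewrite ge0_integral_setU//=; last 3 first.
- exact: measurable_weight.
- by move=> t _; rewrite lee_fin !mulr_ge0 ?expR_ge0 ?powR_ge0.
- apply/disj_setPS => x /=; rewrite !in_itv/= andbT => -[/andP[_ h1] h2].
  by move: (le_lt_trans h1 h2); rewrite ltxx.
apply: lte_add_pinfty.
  apply: (@le_lt_trans _ _ (\int[leb]_(t in `]0%R, 1%R]) (t `^ (- a))%:E)%E); last first.
    by apply: (le_lt_trans integral_powR_01); rewrite ltry.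
  apply: ge0_le_integral => //.
  - by move=> t _; rewrite lee_fin !mulr_ge0 ?expR_ge0 ?powR_ge0.
  - exact: measurable_weight.
  - by apply: measurable_funTS; apply/measurable_EFinP; exact: measurable_powR.
  - move=> t /=; rewrite in_itv/= => /andP[t0 _].
    by rewrite lee_fin ler_piMl ?powR_ge0// !mul1r expR_le1 oppr_le0 ltW.
apply: (@le_lt_trans _ _ (\int[leb]_(t in `[1%R, +oo[)
  (1 * expR (- (1 * t)))%:E)%E); last first.
  by rewrite integral_expR_tail// ltry.
have mE D : measurable_fun D (fun t : R => (1 * expR (- (1 * t)))%:E).
  apply: measurable_funTS; apply/measurable_EFinP; apply: measurable_funM => //.
  exact: measurable_expR_scale.
rewrite -integral_itv_obnd_cbnd//.
apply: ge0_le_integral => //.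
- by move=> t _; rewrite lee_fin !mulr_ge0 ?expR_ge0 ?powR_ge0.
- exact: measurable_weight.
- exact: mE.
- move=> t /=; rewrite in_itv/= andbT => t1.
  rewrite lee_fin ler_piMr ?mulr_ge0 ?expR_ge0//.
  by rewrite -(powRr0 t); apply: ler_powR; [exact: ltW|rewrite oppr_le0 ltW].
Qed.

End gamma_integral.

(** * Two limits for the exponential *)

Section exponential_limits.
Context {R : realType}.

Lemma cvg_half_exp : 2^-1 ^+ n @[n --> \oo] --> (0 : R).
Proof. by apply: cvg_expr; rewrite ger0_norm ?invr_ge0// invf_lt1// ltr1n. Qed.

Lemma one_sub_expRN_le (z : R) : 1 - expR (- z) <= z.
Proof. by have := expR_ge1Dx (- z); lra. Qed.

Lemma one_sub_expRN_ge (z : R) : 0 <= z -> z / (1 + z) <= 1 - expR (- z).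
Proof.
move=> z0; have z1 : 0 < 1 + z by rewrite ltr_pwDl.
have h : expR (- z) <= (1 + z)^-1.
  by rewrite expRN lef_pV2 ?posrE ?expR_gt0// expR_ge1Dx.
rewrite (_ : z / (1 + z) = 1 - (1 + z)^-1); last by field; rewrite gt_eqF.
by rewrite lerB.
Qed.

Lemma cvg_one_sub_expRN (z : R) : 0 <= z ->
  2 ^+ n * (1 - expR (- (z / 2 ^+ n))) @[n --> \oo] --> z.
Proof.
move=> z0; have p2 n : 0 < 2 ^+ n :> R by rewrite exprn_gt0.
apply: (squeeze_cvgr (f := fun n => z / (1 + z * 2^-1 ^+ n)) (h := fun=> z)).
- apply: nearW => n; apply/andP; split; last first.
    by rewrite -ler_pdivlMl// [leRHS]mulrC one_sub_expRN_le.
  rewrite -ler_pdivrMl//.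
  apply: le_trans (one_sub_expRN_ge _); last by rewrite divr_ge0// ltW.
  by rewrite exprVn mulrA [_ * z]mulrC.
- rewrite -[X in _ --> X]divr1; apply: cvgM; first exact: cvg_cst.
  apply: cvgV; first exact: oner_neq0.
  rewrite -[X in _ --> X]addr0; apply: cvgD; first exact: cvg_cst.
  by rewrite -(mulr0 z); apply: cvgM; [exact: cvg_cst|exact: cvg_half_exp].
- exact: cvg_cst.
Qed.

(** Squeeze: expR (- d / (1 - d)) <= 1 - d <= expR (- d), both bounds coming
    from 1 + x <= expR x. *)
Lemma cvg_one_sub_pow (d_ : nat -> R) (d : R) :
  (forall n, 0 <= d_ n <= 1) -> 2 ^+ n * d_ n @[n --> \oo] --> d ->
  (1 - d_ n) ^+ (2 ^ n) @[n --> \oo] --> expR (- d).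
Proof.
move=> d01 dd.
have d0 : d_ n @[n --> \oo] --> (0 : R).
  rewrite (_ : d_ = fun n => 2^-1 ^+ n * (2 ^+ n * d_ n)).
    by rewrite -(mul0r d); apply: cvgM => //; exact: cvg_half_exp.
  by apply/funext => n; rewrite exprVn mulKf// gt_eqF// exprn_gt0.
have d1 : 1 - d_ n @[n --> \oo] --> (1 : R).
  by rewrite -[X in _ --> X]subr0; apply: cvgB => //; exact: cvg_cst.
apply: (squeeze_cvgr (f := fun n => expR (- (2 ^+ n * d_ n / (1 - d_ n))))
  (h := fun n => expR (- (2 ^+ n * d_ n)))).
- near=> n; have /andP[d_ge0 d_le1] := d01 n.
  have d_lt1 : 0 < 1 - d_ n.
    near: n; apply: (cvgr_gt 1) => //.
  have e x : expR (- (2 ^+ n * x)) = expR (- x) ^+ (2 ^ n).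
    by rewrite -expRM_natl natrX mulrN.
  rewrite -mulrA !e; apply/andP; split.
    rewrite lerXn2r ?nnegrE ?expR_ge0 ?(ltW d_lt1)//.
    rewrite expRN -[leRHS]invrK lef_pV2 ?posrE ?expR_gt0 ?invr_gt0//.
    apply: le_trans (expR_ge1Dx _).
    by rewrite le_eqVlt; apply/orP; left; apply/eqP; field; rewrite gt_eqF.
  rewrite lerXn2r ?nnegrE ?expR_ge0 ?(ltW d_lt1)//.
  by have := expR_ge1Dx (- d_ n); lra.
- apply: continuous_cvg; first exact: continuous_expR.
  apply: cvgN; rewrite -[X in _ --> X]divr1; apply: cvgM => //.
  by apply: cvgV => //; exact: oner_neq0.
- apply: continuous_cvg; first exact: continuous_expR.
  exact: cvgN.
Unshelve. all: by end_near. Qed.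

End exponential_limits.

(** * Frechet laws *)

Section frechet.
Context {R : realType}.
Local Notation leb := (@lebesgue_measure R).
Variable a : R.
Hypothesis a01 : 0 < a < 1.
Let a_gt0 : 0 < a. Proof. by case/andP: a01. Qed.

Definition frechet (c t : R) : R :=
  if 0 < t then expR (- (c * t `^ (- a))) else 0.

Lemma frechet_ge0 c t : 0 <= frechet c t.
Proof. by rewrite /frechet; case: ifP => // _; rewrite expR_ge0. Qed.

Lemma frechet_le1 c t : 0 <= c -> frechet c t <= 1.
Proof.
move=> c0; rewrite /frechet; case: ifP => // _.
by rewrite expR_le1 oppr_le0 mulr_ge0// powR_ge0.
Qed.

(** Max-stability: the maximum of two independent variables of parameter
    [c / 2] has parameter [c]. *)
Lemma frechet_half c t : frechet (c / 2) t * frechet (c / 2) t = frechet c t.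
Proof.
rewrite /frechet; case: ifP => _; last by rewrite mulr0.
by rewrite -expRD -opprD -mulrDl -splitr.
Qed.

Lemma frechet_nondecreasing c : 0 <= c -> {homo frechet c : x y / x <= y}.
Proof.
move=> c0 x y xy; rewrite /frechet; case: ifPn => x0; last first.
  by case: ifPn => _ //; rewrite expR_ge0.
have y0 := lt_le_trans x0 xy; rewrite y0 ler_expR lerN2 ler_wpM2l//.
rewrite !powRN lef_pV2 ?posrE ?powR_gt0// ge0_ler_powR ?nnegrE// ?ltW//.
Qed.

Lemma cvg_powRN_y : t `^ (- a) @[t --> +oo] --> (0 : R).
Proof.
apply/cvgrPdist_le => e e0; near=> t.
have t0 : 0 < t by near: t; exact: nbhs_pinfty_gt.
rewrite sub0r normrN ger0_norm ?powR_ge0// powRN invf_ple ?posrE ?powR_gt0//.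
have -> : e^-1 = (e^-1 `^ a^-1) `^ a.
  by rewrite -powRrM mulVf ?gt_eqF// powRr1// invr_ge0 ltW.
have ht : e^-1 `^ a^-1 <= t by near: t; apply: nbhs_pinfty_ge; rewrite num_real.
by apply: (ge0_ler_powR (ltW a_gt0)); rewrite ?nnegrE ?powR_ge0 ?(ltW t0).
Unshelve. all: by end_near. Qed.

Lemma frechet_cvgy c : frechet c t @[t --> +oo] --> (1 : R).
Proof.
have h : expR (- (c * t `^ (- a))) @[t --> +oo] --> (1 : R).
  rewrite -expR0; apply: continuous_cvg; first exact: continuous_expR.
  rewrite -oppr0 -(mulr0 c); apply: cvgN; apply: cvgM; first exact: cvg_cst.
  exact: cvg_powRN_y.
apply: cvg_trans h; apply: near_eq_cvg; near=> t.
by rewrite /frechet ifT//; near: t; exact: nbhs_pinfty_gt.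
Unshelve. all: by end_near. Qed.

Lemma frechet_cvgNy c : frechet c t @[t --> -oo] --> (0 : R).
Proof.
apply: cvg_near_cst; near=> t; rewrite /frechet ifF//.
by apply/negbTE; rewrite -leNgt; near: t; apply: nbhs_ninfty_le; rewrite num_real.
Unshelve. all: by end_near. Qed.

(** At 0 the function is squeezed by [c^-1 * t `^ a], because
    expR (- u) <= u^-1 for u > 0. *)
Lemma frechet_right_continuous c : 0 < c -> right_continuous (frechet c).
Proof.
move=> c0 x; have [x0|x0] := ltP 0 x.
- apply: cvg_at_right_filter.
  have h : {for x, continuous (fun t => expR (- (c * t `^ (- a))))}.
    apply: continuous_comp; last exact: continuous_expR.
    apply: cvgN; apply: cvgM; first exact: cvg_cst.
    exact: continuous_powR.
  have -> : frechet c x = expR (- (c * x `^ (- a))) by rewrite /frechet x0.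
  apply: cvg_trans h; apply: near_eq_cvg; near=> t.
  by rewrite /frechet ifT//; near: t; exact: lt_nbhsr.
- have -> : frechet c x = 0 by rewrite /frechet ltNge x0.
  move: x0; rewrite le_eqVlt => /orP[/eqP ->|x0].
    apply: (squeeze_cvgr (f := fun=> 0) (h := fun t => c^-1 * t `^ a)).
    + near=> t; rewrite frechet_ge0/=.
      have t0 : 0 < t by near: t; exact: nbhs_right_gt.
      rewrite /frechet t0 expRN.
      rewrite invf_ple ?posrE ?expR_gt0 ?mulr_gt0 ?invr_gt0 ?powR_gt0//.
      rewrite invfM invrK -powRN; apply: le_trans (expR_ge1Dx _).
      by rewrite lerDr.
    + exact: cvg_cst.
    + by rewrite -[X in _ --> X](mulr0 c^-1); apply: cvgM; [exact: cvg_cst|exact: powR_cvg0].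
  apply: cvg_at_right_filter; apply: cvg_near_cst; near=> t.
  rewrite /frechet ifF//; apply/negbTE; rewrite -leNgt ltW//.
  by near: t; exact: lt_nbhsl.
Unshelve. all: by end_near. Qed.

Lemma exists_frechet c : 0 < c -> exists P : probability (measurableTypeR R) R,
  forall t : R, P `]-oo, t]%classic = (frechet c t)%:E.
Proof.
move=> c0; apply: exists_probability_cdf.
- exact/frechet_nondecreasing/ltW.
- exact: frechet_right_continuous.
- exact: frechet_cvgNy.
- exact: frechet_cvgy.
Qed.

End frechet.

(** * The one-sided stable law *)

Section frechet_limit.
Context {R : realType}.
Local Notation leb := (@lebesgue_measure R).
Variable a : R.
Hypothesis a01 : 0 < a < 1.

(** One minus the Laplace transform of the Frechet law, as an integral of its
    tail; see [laplace_frechet]. *)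
Definition frechet_defect (c s : R) : \bar R :=
  (\int[leb]_(t in `]0%R, +oo[) (s * expR (- (s * t)) * (1 - frechet a c t))%:E)%E.

Let measurable_exp s D : measurable_fun D (fun t : R => s * expR (- (s * t))).
Proof.
apply: measurable_funTS; apply: measurable_funM => //.
exact: measurable_expR_scale.
Qed.

Lemma measurable_frechet c D : measurable_fun D (frechet a c).
Proof.
apply: measurable_funTS; apply: measurable_fun_ifT => //.
  exact: measurable_fun_ltr.
apply: measurableT_comp => //; apply: measurableT_comp => //.
by apply: measurable_funM => //; exact: measurable_powR.
Qed.

Lemma laplace_frechet (P : probability (measurableTypeR R) R) c s :
  0 <= c -> 0 < s -> (forall t : R, P `]-oo, t]%classic = (frechet a c t)%:E) ->
  (laplace P s + frechet_defect c s)%E = 1%E.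
Proof.
move=> c0 s0 Pf; rewrite laplace_layer_cake//; last first.
  by move=> t t0; have := Pf t; rewrite /frechet ltNge t0.
rewrite -ge0_integralD//=; last 4 first.
- by move=> t _; rewrite mule_ge0// lee_fin mulr_ge0 ?expR_ge0// ltW.
- apply: emeasurable_funM.
    by apply/measurable_EFinP; exact: measurable_exp.
  apply: measurable_funTS.
  apply: (eq_measurable_fun (EFin \o frechet a c)).
    by move=> t _; exact/esym/Pf.
  by apply/measurable_EFinP; exact: measurable_frechet.
- by move=> t _; rewrite lee_fin !mulr_ge0 ?expR_ge0 ?(ltW s0)// subr_ge0 frechet_le1.
- apply/measurable_EFinP; apply: measurable_funM; first exact: measurable_exp.
  by apply: measurable_funB => //; exact: measurable_frechet.
transitivity (\int[leb]_(t in `]0%R, +oo[) (s * expR (- (s * t)))%:E)%E.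
  apply: eq_integral => t _.
  transitivity ((s * expR (- (s * t)) * frechet a c t)%:E +
    (s * expR (- (s * t)) * (1 - frechet a c t))%:E)%E.
    by rewrite [in RHS]EFinM; congr (_ * _ + _)%E; exact: Pf.
  by rewrite -EFinD; congr EFin; ring.
rewrite integral_itv_obnd_cbnd; last by apply/measurable_EFinP; exact: measurable_exp.
by rewrite integral_expR_tail// mulr0 oppr0 expR0.
Qed.

Lemma frechet_defect_ge0 c s : 0 <= c -> 0 < s -> (0 <= frechet_defect c s)%E.
Proof.
move=> c0 s0; apply: integral_ge0 => t _.
by rewrite lee_fin !mulr_ge0 ?expR_ge0 ?(ltW s0)// subr_ge0 frechet_le1.
Qed.

(** With [N = 2 ^+ n], the rescaled tail N * (1 - expR (- (z / N))) tends to
    [z] and is bounded by it, where [z = c * t `^ (- a)]; the bound is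
    integrable against the exponential because [a < 1]. *)
Lemma cvg_frechet_defect c s : 0 < c -> 0 < s ->
  ((2 ^+ n)%:E * frechet_defect (c / 2 ^+ n) s)%E @[n --> \oo] -->
  (c%:E * power_laplace a s)%E.
Proof.
move=> c0 s0; have p2 n : 0 < 2 ^+ n :> R by rewrite exprn_gt0.
have mf n : measurable_fun setT (fun t : R =>
    s * expR (- (s * t)) * (1 - frechet a (c / 2 ^+ n) t)).
  apply: measurable_funM; first exact: measurable_exp.
  by apply: measurable_funB => //; exact: measurable_frechet.
have f0 n (t : R) : 0 <= s * expR (- (s * t)) * (1 - frechet a (c / 2 ^+ n) t).
  rewrite !mulr_ge0 ?expR_ge0// ?(ltW s0)// subr_ge0 frechet_le1//.
  by rewrite divr_ge0// ltW.
have mw : measurable_fun setT (fun t : R => s * expR (- (s * t)) * t `^ (- a)).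
  by apply: measurable_funM; [exact: measurable_exp|exact: measurable_powR].
have w0 (t : R) : 0 <= s * expR (- (s * t)) * t `^ (- a).
  by rewrite !mulr_ge0 ?expR_ge0 ?powR_ge0// ltW.
have -> : (fun n => ((2 ^+ n)%:E * frechet_defect (c / 2 ^+ n) s)%E) = fun n =>
    (\int[leb]_(t in `]0%R, +oo[) (2 ^+ n *
      (s * expR (- (s * t)) * (1 - frechet a (c / 2 ^+ n) t)))%:E)%E.
  apply/funext => n; rewrite /frechet_defect -ge0_integralZl_EFin//.
  - by move=> t _; rewrite lee_fin.
  - by apply/measurable_EFinP; apply: measurable_funTS; exact: mf.
rewrite /power_laplace -ge0_integralZl_EFin//; last 3 first.
- by move=> t _; rewrite lee_fin.
- by apply/measurable_EFinP; exact: measurable_funTS.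
- exact: ltW.
pose g (t : R) := (c%:E * (s * expR (- (s * t)) * t `^ (- a))%:E)%E.
have mg : measurable_fun (`]0, +oo[%classic : set R) g.
  by apply: measurable_funTS; apply: measurable_funeM; exact/measurable_EFinP.
apply: (@dominated_cvg _ _ _ leb _ _
  (fun n t => (2 ^+ n *
    (s * expR (- (s * t)) * (1 - frechet a (c / 2 ^+ n) t)))%:E)
  g g) => //.
- move=> n; apply/measurable_EFinP; apply: measurable_funTS.
  apply: measurable_funM => //; exact: mf.
- move=> t /=; rewrite in_itv/= andbT => t0; rewrite /g -EFinM.
  apply: cvg_EFin; first exact: nearW.
  rewrite (_ : _ \o _ = fun n => (s * expR (- (s * t))) *
    (2 ^+ n * (1 - expR (- ((c * t `^ (- a)) / 2 ^+ n))))); last first.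
    by apply/funext => n /=; rewrite /frechet t0 mulrCA (mulrAC c).
  rewrite mulrCA; apply: cvgM; first exact: cvg_cst.
  by apply: cvg_one_sub_expRN; rewrite mulr_ge0 ?powR_ge0// ltW.
- apply/integrableP; split => //.
  under eq_integral do rewrite gee0_abs ?mule_ge0 ?lee_fin ?(ltW c0)//.
  rewrite ge0_integralZl_EFin ?(ltW c0)//; last 2 first.
  + by move=> t _; rewrite lee_fin.
  + by apply/measurable_EFinP; exact: measurable_funTS.
  by rewrite lte_mul_pinfty ?lee_fin ?(ltW c0)//; exact: power_laplace_lty.
- move=> n t /=; rewrite in_itv/= andbT => t0.
  rewrite /g -EFinM lee_fin ger0_norm; last by rewrite mulr_ge0// ltW.
  rewrite /frechet t0.
  rewrite mulrCA [leRHS]mulrCA ler_wpM2l ?mulr_ge0 ?expR_ge0 ?(ltW s0)//.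
  by rewrite -ler_pdivlMl// mulrA (mulrC _ c) one_sub_expRN_le.
Qed.

(** The laws obtained by doubling the Frechet law of parameter [c / 2 ^+ n]
    [n] times increase stochastically; the constant [c] is fixed so that the
    limiting exponent is [k]. *)
Lemma exists_stable_measure (k : R) : 0 < k ->
  exists P : borel_measure R, forall s, 0 < s ->
    laplace P s = (expR (- (k * s `^ a)))%:E.
Proof.
move=> k0.
have w_fin : power_laplace a 1 \is a fin_num.
  by rewrite ge0_fin_numE ?power_laplace_lty// ltW// power_laplace1_gt0.
pose w := fine (power_laplace a 1).
have w0 : 0 < w by rewrite -lte_fin fineK// power_laplace1_gt0.
(* w stands for Gamma(1 - a). *)
pose c := k / w; have c0 : 0 < c by rewrite divr_gt0.
have c2 n : 0 < c / 2 ^+ n by rewrite divr_gt0// exprn_gt0.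
pose nu n := projT1 (cid (exists_frechet a01 (c2 n))).
have nuE n (t : R) : nu n `]-oo, t]%classic = (frechet a (c / 2 ^+ n) t)%:E.
  exact: (projT2 (cid (exists_frechet a01 (c2 n)))).
have nu0 n : nu n `]-oo, 0%R]%classic = 0%E by rewrite nuE /frechet ltxx.
pose mu n := convolve_double n (nu n).
(* Pair the 2 ^ n.+1 terms: each sum of two dominates a term of the previous law. *)
have mule n : st_le (mu n) (mu n.+1).
  rewrite /mu /convolve_double iterSr; apply: st_le_convolve_double => x.
  apply: le_trans (convolve_le_max x (nu0 n.+1)) _.
  rewrite !nuE -EFinM lee_fin -(frechet_half a (c / 2 ^+ n)).
  by rewrite exprSr invfM mulrA.
have [P PL] := st_le_cvg_laplace (mu := mu) (nu0 0%N) mule.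
exists P => s s0.
pose d n := fine (frechet_defect (c / 2 ^+ n) s).
have lap_ge0 n : (0 <= laplace (nu n) s)%E.
  by apply: integral_ge0 => x _; rewrite lee_fin expR_ge0.
have d_ge0 n := frechet_defect_ge0 (ltW (c2 n)) s0.
have lapD n := laplace_frechet (ltW (c2 n)) s0 (nuE n).
have dE n : frechet_defect (c / 2 ^+ n) s = (d n)%:E.
  rewrite fineK// ge0_fin_numE// (@le_lt_trans _ _ 1%E) ?ltry//.
  by rewrite -(lapD n) leeDr.
have lapE n : laplace (nu n) s = (1 - d n)%:E.
  have := lapD n; rewrite dE; case: (laplace (nu n) s) => //= r [rd].
  by rewrite -rd addrK.
have d01 n : 0 <= d n <= 1.
  by rewrite -!lee_fin -dE d_ge0 dE lee_fin -subr_ge0 -lee_fin -lapE lap_ge0.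
have dcvg : 2 ^+ n * d n @[n --> \oo] --> k * s `^ a.
  have := cvg_frechet_defect c0 s0.
  rewrite power_laplace_homogeneous// -(fineK w_fin) -/w -!EFinM.
  rewrite (_ : c * _ = k * s `^ a); last by rewrite /c; field; rewrite gt_eqF.
  under eq_fun do rewrite dE -EFinM.
  by move/fine_cvg.
have := PL _ s0 => /cvg_lim <-//; apply/cvg_lim => //.
rewrite (_ : (fun n => _) = fun n => ((1 - d n) ^+ (2 ^ n))%:E).
  by apply: cvg_EFin; [exact: nearW|exact: cvg_one_sub_pow].
by apply/funext => n; rewrite (laplace_convolve_double _ (lapE n)).
Qed.

End frechet_limit.


(** * Exponential families whose mean is a power *)

Section power_means.
Context {R : realType}.
Implicit Types mu : borel_measure R.

Lemma near_gt0 (x : R) (P : R -> Prop) : 0 < x -> (forall y, 0 < y -> P y) ->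
  \forall y \near x, P y.
Proof.
by move=> x0 HP; near=> y; apply: HP; near: y; exact: lt_nbhsr.
Unshelve. all: by end_near. Qed.

Lemma derive1_power (f : R -> R) (A e : R) :
  (forall s, 0 < s -> f s = A * s `^ e) ->
  forall s, 0 < s -> derive1 f s = A * (e * s `^ (e - 1)).
Proof.
move=> fE s s0; rewrite derive1E.
rewrite (near_eq_derive (g := fun s => A * s `^ e)); last exact: near_gt0.
by have [_] := is_deriveZ A (is_derive1_powR e s0).
Qed.

Lemma power_inverse (A g s m : R) : 0 < A -> 0 < g -> 0 < s -> 0 < m ->
  A * s `^ (- g) = m -> s = A `^ g^-1 * m `^ (- g^-1).
Proof.
move=> A0 g0 s0 m0 <-; rewrite powRM ?powR_ge0 ?(ltW A0)// mulrA.
rewrite -powRD ?subrr ?(gt_eqF A0) ?implybT// powRr0 mul1r -powRrM.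
by rewrite mulrNN divff ?gt_eqF// powRr1// ltW.
Qed.

Lemma power_inverseK (A g m : R) : 0 < A -> 0 < g -> 0 < m ->
  A * (A `^ g^-1 * m `^ (- g^-1)) `^ (- g) = m.
Proof.
move=> A0 g0 m0; rewrite powRM ?powR_ge0// -!powRrM.
rewrite mulrN mulrNN mulVf ?gt_eqF// powRN !powRr1 ?ltW//.
by rewrite mulrA divff ?mul1r// gt_eqF.
Qed.

(** The variance function is minus the derivative of the mean, evaluated where
    the mean equals [m]; the inverse of [A * s `^ (- g)] is again a power. *)
Lemma power_mean_variance mu (A g : R) : 0 < A -> 0 < g ->
  laplace_dom mu = `]0, +oo[%classic ->
  (forall s, 0 < s -> nef_mean mu s = A * s `^ (- g)) ->
  mean_dom mu = `]0, +oo[%classic /\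
  forall m, 0 < m -> variance_fun mu m = g * A `^ (- g^-1) * m `^ (1 + g^-1).
Proof.
move=> A0 g0 dom mean.
have inj : {in laplace_dom mu &, injective (nef_mean mu)}.
  move=> s t; rewrite dom !inE/= !in_itv/= !andbT => s0 t0.
  rewrite !mean// => st.
  have m0 : 0 < A * t `^ (- g) by rewrite mulr_gt0 ?powR_gt0.
  by transitivity (A `^ g^-1 * (A * t `^ (- g)) `^ (- g^-1)); [|symmetry];
    apply: power_inverse.
split.
  rewrite /mean_dom dom; apply/seteqP; split => m /=.
    move=> [s]; rewrite in_itv/= andbT => s0 <-.
    by rewrite in_itv/= andbT mean// mulr_gt0 ?powR_gt0.
  rewrite in_itv/= andbT => m0.
  have s0 : 0 < A `^ g^-1 * m `^ (- g^-1) by rewrite mulr_gt0 ?powR_gt0.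
  exists (A `^ g^-1 * m `^ (- g^-1)); first by rewrite /= in_itv/= s0.
  by rewrite mean// power_inverseK.
move=> m m0; pose s := A `^ g^-1 * m `^ (- g^-1).
have s0 : 0 < s by rewrite mulr_gt0 ?powR_gt0.
have sm : nef_mean mu s = m by rewrite mean// power_inverseK.
have -> : variance_fun mu m = derive1n 2 (log_laplace mu) s.
  rewrite /variance_fun; congr derive1n.
  by rewrite /mean_inv -sm pinvKV// inE dom/= in_itv/= s0.
rewrite /derive1n/= (@derive1_power _ (- A) (- g))//; last first.
  by move=> t t0; rewrite mulNr -mean// /nef_mean opprK.
rewrite mulNr mulNr mulrN opprK /s powRM ?powR_ge0// -!powRrM.
rewrite (_ : g^-1 * (- g - 1) = - 1 - g^-1); last by field; rewrite gt_eqF.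
rewrite (_ : - g^-1 * (- g - 1) = 1 + g^-1); last by field; rewrite gt_eqF.
rewrite powRB ?(gt_eqF A0) ?implybT// powRN powRr1 ?ltW// -powRN.
by field; rewrite gt_eqF.
Qed.

(** The derivative is defined as a limit, which takes the default value 0 when
    the difference quotient diverges. *)
Lemma derivable_derive1_neq0 (f : R -> R) x : derive1 f x != 0 -> derivable f x 1.
Proof.
apply: contra_neqP => nd; rewrite /derive1 /lim /lim_in xgetPN.
  by [].
move=> l /= h; apply: nd; apply/cvg_ex; exists l => /=.
apply: cvg_trans h; apply: near_eq_cvg; near=> h.
by rewrite /= /GRing.scale/= mulr1.
Unshelve. all: by end_near. Qed.

Lemma laplace_pos mu s : (mu setT != 0)%E -> (0 < laplace mu s)%E.
Proof.
move=> mu0; rewrite lt0e; apply/andP; split; last first.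
  by apply: integral_ge0 => x _; rewrite lee_fin expR_ge0.
apply: contra mu0 => /eqP L0.
have mE : measurable_fun setT (fun x : measurableTypeR R => (expR (- (s * x)))%:E).
  by apply/measurable_EFinP; exact: measurable_expR_scale.
have : (\int[mu]_x `|(expR (- (s * x)))%:E| = 0)%E.
  by rewrite -[RHS]L0; apply: eq_integral => x _; rewrite gee0_abs// lee_fin expR_ge0.
move=> /(ae_eq_integral_abs mu measurableT mE) [N [mN N0 NT]].
rewrite -measure_le0 -N0 le_measure ?inE// => x _; apply: NT => /= /(_ I) [].
by apply/eqP; rewrite gt_eqF// expR_gt0.
Qed.

(** Convexity of the Laplace transform, inherited from the exponential and
    written without denominators so that infinite values are covered. *)
Lemma laplace_convex mu (r s t : R) : r < s -> s < t ->
  ((t - r)%:E * laplace mu s <=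
   (t - s)%:E * laplace mu r + (s - r)%:E * laplace mu t)%E.
Proof.
move=> rs st; have rt := lt_trans rs st.
have mE u : measurable_fun setT (fun x : measurableTypeR R => (expR (- (u * x)))%:E).
  by apply/measurable_EFinP; exact: measurable_expR_scale.
have e0 u x : (0 <= (expR (- (u * x)))%:E)%E by rewrite lee_fin expR_ge0.
rewrite /laplace -!ge0_integralZl//; last 3 first.
- by rewrite lee_fin subr_ge0 ltW.
- by rewrite lee_fin subr_ge0 ltW.
- by rewrite lee_fin subr_ge0 ltW.
rewrite -ge0_integralD//; last 4 first.
- by move=> x _; rewrite mule_ge0// lee_fin subr_ge0 ltW.
- exact: measurable_funeM.
- by move=> x _; rewrite mule_ge0// lee_fin subr_ge0 ltW.
- exact: measurable_funeM.
apply: ge0_le_integral => //.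
- by move=> x _; rewrite mule_ge0// lee_fin subr_ge0 ltW.
- exact: measurable_funeM.
- by apply: emeasurable_funD; exact: measurable_funeM.
move=> x _; rewrite -!EFinM -EFinD lee_fin.
(* The tangent line of u |-> expR (- (u * x)) at s lies below the graph. *)
have tangent u : expR (- (s * x)) * (1 + (s - u) * x) <= expR (- (u * x)).
  rewrite (_ : - (u * x) = - (s * x) + (s - u) * x); last by ring.
  by rewrite expRD ler_wpM2l ?expR_ge0// expR_ge1Dx.
have := ler_wpM2l (_ : 0 <= t - s) (tangent r).
have := ler_wpM2l (_ : 0 <= s - r) (tangent t).
rewrite !subr_ge0 => /(_ (ltW rs)) h1 /(_ (ltW st)) h2.
apply: le_trans (lerD h2 h1).
by rewrite le_eqVlt; apply/orP; left; apply/eqP; ring.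
Qed.

Lemma laplace_dom_lty mu s : laplace_dom mu s -> (laplace mu s < +oo)%E.
Proof. exact: interior_subset. Qed.

(** If the Laplace transform [B] were finite at some r < 0, convexity would
    bound its slopes on (0, 1) by [B r / - r].  The slopes are also at least
    [B 1 * (A * t `^ (- g))] in absolute value, by the mean value theorem
    applied to the logarithm of [B]; this is unbounded as t tends to 0. *)
Lemma power_mean_laplace_dom mu (A g : R) : 0 < A -> 0 < g ->
  (mu setT != 0)%E -> `]0, +oo[%classic `<=` laplace_dom mu ->
  (forall s, 0 < s -> nef_mean mu s = A * s `^ (- g)) ->
  laplace_dom mu = `]0, +oo[%classic.
Proof.
move=> A0 g0 mu0 domS mean; apply/seteqP; split => // r0 rdom.
rewrite /= in_itv/= andbT ltNge; apply/negP => r0_le0.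
have [r r_lt0 rfin] : exists2 r, r < 0 & (laplace mu r < +oo)%E.
  move: rdom; rewrite /laplace_dom /interior/= => /nbhs_ballP[e /= e0 He].
  exists (r0 - e / 2); first by rewrite subr_lt0 (le_lt_trans r0_le0)// divr_gt0.
  apply: He; rewrite /ball/= opprB addrC subrK ger0_norm ?divr_ge0 ?ltW//.
  by rewrite ltr_pdivrMr// ltr_pMr// ltr1n.
pose B s := fine (laplace mu s).
have BE s : (laplace mu s < +oo)%E -> laplace mu s = (B s)%:E.
  by move=> h; rewrite fineK// ge0_fin_numE// ltW// laplace_pos.
have Bpos s : (laplace mu s < +oo)%E -> 0 < B s.
  by move=> h; rewrite -lte_fin -BE// laplace_pos.
have fin s : 0 < s -> (laplace mu s < +oo)%E.
  by move=> s0; apply: laplace_dom_lty; apply: domS; rewrite /= in_itv/= s0.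
pose ell := log_laplace mu.
have ellE s : 0 < s -> expR (ell s) = B s.
  by move=> s0; rewrite lnK// posrE Bpos// fin.
have dell (s : R) : 0 < s -> is_derive s 1 ell (- (A * s `^ (- g))).
  move=> s0.
  have e : - derive1 ell s = A * s `^ (- g) by exact: mean.
  rewrite -e opprK derive1E; apply/derivableP/derivable_derive1_neq0.
  by rewrite -oppr_eq0 e gt_eqF// mulr_gt0// powR_gt0.
(* Lower bound on the slope of B, from ell = ln B and 1 + x <= expR x. *)
have lower s t : 0 < s -> s < t -> B t * (A * t `^ (- g)) * (t - s) <= B s - B t.
  move=> s0 st; have t0 := lt_trans s0 st.
  have [c] : exists2 c, c \in `]s, t[ &
      ell t - ell s = - (A * c `^ (- g)) * (t - s).
    apply: MVT => //.
      by move=> x; rewrite in_itv/= => /andP[sx _]; apply: dell; exact: lt_trans sx.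
    apply: derivable_within_continuous => x; rewrite in_itv/= => /andP[sx _].
    by have [] := dell _ (lt_le_trans s0 sx).
  rewrite in_itv/= => /andP[sc ct] ellc; have c0 := lt_trans s0 sc.
  have tc : A * t `^ (- g) * (t - s) <= ell s - ell t.
    rewrite -[leRHS]opprB ellc mulNr opprK ler_wpM2r ?subr_ge0 ?(ltW st)//.
    rewrite ler_wpM2l ?(ltW A0)// !powRN lef_pV2 ?posrE ?powR_gt0//.
    by apply: (ge0_ler_powR (ltW g0)); rewrite ?nnegrE ltW.
  rewrite lerBrDl -[X in X + _]mulr1 -mulrA -mulrDr.
  rewrite -(ellE _ s0) -(subrK (ell t) (ell s)) expRD ellE// [leRHS]mulrC.
  rewrite ler_wpM2l ?(ltW (Bpos _ (fin _ t0)))//.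
  by apply: le_trans (expR_ge1Dx _); rewrite lerD2l.
(* Upper bound on the slope of B, from convexity between r, s and t. *)
have upper s t : 0 < s -> s < t -> (t - r) * (B s - B t) <= (t - s) * B r.
  move=> s0 st; have t0 := lt_trans s0 st.
  have := laplace_convex mu (lt_trans r_lt0 s0) st.
  rewrite (BE _ rfin) (BE _ (fin _ s0)) (BE _ (fin _ t0)) -!EFinM -EFinD lee_fin => h.
  have := mulr_ge0 (_ : 0 <= t - s) (ltW (Bpos _ (fin _ t0))).
  by rewrite subr_ge0 => /(_ (ltW st)) h'; lra.
have bound t : 0 < t -> t < 1 -> B 1 * (A * t `^ (- g)) * (- r) <= B r.
  move=> t0 t1.
  have B1t : B 1 <= B t.
    rewrite -subr_ge0; apply: le_trans (lower _ _ t0 t1).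
    by rewrite !mulr_ge0 ?powR_ge0 ?(ltW A0) ?(ltW (Bpos _ (fin _ _)))// subr_ge0 ltW.
  have t20 : 0 < t / 2 by rewrite divr_gt0.
  have t2t : t / 2 < t by rewrite ltr_pdivrMr// ltr_pMr// ltr1n.
  have tr0 : 0 < t - r by rewrite subr_gt0 (lt_trans r_lt0).
  have d0 : 0 < t - t / 2 by rewrite subr_gt0.
  rewrite -(ler_pM2l d0); apply: le_trans (upper _ _ t20 t2t).
  apply: le_trans (ler_wpM2l (ltW tr0) (lower _ _ t20 t2t)).
  rewrite [leRHS]mulrA [leRHS]mulrC (ler_pM2l d0) [leRHS]mulrC.
  apply: ler_pM; rewrite ?oppr_ge0 ?(ltW r_lt0)//.
  - by rewrite !mulr_ge0 ?powR_ge0 ?(ltW A0) ?(ltW (Bpos _ (fin _ _))).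
  - by rewrite ler_wpM2r// mulr_ge0 ?powR_ge0 ?(ltW A0).
  - by rewrite lerDr ltW.
have B1 : 0 < B 1 by rewrite Bpos// fin.
have K0 : 0 < B 1 * A * - r by rewrite !mulr_gt0// oppr_gt0.
pose M := B r / (B 1 * A * - r).
have M0 : 0 < M by rewrite divr_gt0// Bpos.
(* This t satisfies t `^ (- g) = M + 2, and adding 2 > 1 makes t < 1. *)
pose t := (M + 2) `^ (- g^-1).
have t0 : 0 < t by rewrite powR_gt0// addr_gt0.
have t1 : t < 1.
  rewrite /t powRN invf_lt1 ?powR_gt0 ?addr_gt0//.
  rewrite [ltLHS](_ : 1 = 1 `^ g^-1); last by rewrite powR1.
  by apply: gt0_ltr_powR; rewrite ?invr_gt0 ?nnegrE//; lra.
have := bound t t0 t1; rewrite /t -powRrM mulrNN mulVf ?gt_eqF// powRr1; last by lra.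
rewrite (_ : _ * - r = (B 1 * A * - r) * (M + 2)); last by ring.
rewrite mulrDr {1}/M mulrC divfK ?gt_eqF// gerDl leNgt.
by rewrite mulr_gt0.
Qed.

End power_means.

(** * Stable laws are not degenerate, and the duality *)

Lemma laplace_concentrated (R : realType) (mu : borel_measure R) (c s : R) :
  mu (~` [set c]) = 0%E ->
  laplace mu s = ((expR (- (s * c)))%:E * mu setT)%E.
Proof.
move=> mu0; rewrite -integral_cst// /laplace.
apply: ge0_ae_eq_integral => //.
- by apply/measurable_EFinP; exact: measurable_expR_scale.
- by move=> x _; rewrite lee_fin expR_ge0.
- exists (~` [set c]); split => //; first exact: measurableC.
  by move=> x /= /not_implyP[_ h] xc; apply: h; rewrite xc.
Qed.

(** The logarithm of the Laplace transform of a point mass is affine, whereas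
    [s `^ a] takes values at 1, 2 and 4 that are not affine in [s]. *)
Lemma stable_not_concentrated (R : realType) (mu : borel_measure R) (k a : R) :
  0 < k -> 0 < a < 1 ->
  (forall s, 0 < s -> laplace mu s = (expR (- (k * s `^ a)))%:E) ->
  ~ exists c, mu (~` [set c]) = 0%E.
Proof.
move=> k0 /andP[a0 a1] L [c /laplace_concentrated H].
have L1 := L 1 ltr01.
have : (mu setT \is a fin_num).
  rewrite ge0_fin_numE// ltNge leye_eq; apply/negP => /eqP mT.
  by move: L1; rewrite H mT gt0_muley ?lte_fin ?expR_gt0.
move=> /fineK; set w := fine _ => wE.
have E s : 0 < s -> expR (- (s * c)) * w = expR (- (k * s `^ a)).
  by move=> s0; have := L s s0; rewrite H -wE -EFinM => -[].
have w0 : 0 < w.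
  by rewrite -(@pmulr_rgt0 _ (expR (- (1 * c)))) ?expR_gt0// E// expR_gt0.
have lnE s : 0 < s -> ln w - s * c = - (k * s `^ a).
  move=> s0; apply: expR_inj; rewrite -E// expRD lnK ?posrE//; exact: mulrC.
have e1 := lnE 1 ltr01; have e2 := lnE 2 (ltr0n _ 2); have e4 := lnE 4 (ltr0n _ 4).
pose u : R := 2 `^ a.
have u4 : 4 `^ a = u * u :> R.
  by rewrite /u -powRM// -natrM.
rewrite powR1 in e1; rewrite -/u in e2; rewrite u4 in e4.
have u1 : 1 < u.
  rewrite [ltLHS](_ : 1 = 1 `^ a); last by rewrite powR1.
  by apply: gt0_ltr_powR; rewrite ?nnegrE// ltr1n.
have u2 : u < 2.
  have -> : u = 2 `^ (a - 1) * 2 by rewrite /u mulrC mulr_powRB1.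
  rewrite gtr_pMl// -opprB powRN invf_lt1 ?powR_gt0//.
  rewrite [ltLHS](_ : 1 = 1 `^ (1 - a)); last by rewrite powR1.
  by apply: gt0_ltr_powR; rewrite ?nnegrE// ?subr_gt0// ltr1n.
have : k * ((u - 1) * (2 - u)) = 0 by lra.
apply/eqP; rewrite gt_eqF// !mulr_gt0// subr_gt0//.
Qed.

Lemma pos_subset_interior (R : realType) (A : set R) :
  (forall s, 0 < s -> A s) -> `]0, +oo[%classic `<=` interior A.
Proof.
move=> HA; rewrite -open_subsetE; last exact: interval_open.
by move=> s /=; rewrite in_itv/= andbT; exact: HA.
Qed.

Theorem proposition2 (R : realType) (p q lambda beta : R)
  (p_gt1 : 1 < p) (p_lt2 : p < 2) (lambda_gt0 : 0 < lambda)
  (conj_pq : 1 / p + 1 / q = 1)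
  (beta_def : beta = (2 - p) / (p - 1))
  (mu : borel_measure R)
  (mu_gen : generating_measure mu)
  (mu_dom : laplace_dom mu = `]0, +oo[%classic)
  (mu_log : forall s : R, 0 < s ->
     log_laplace mu s =
       lambda * ((p - 1) `^ (- beta) / (2 - p)) * (1 / s `^ beta)) :
  (mean_dom mu = `]0, +oo[%classic /\
   forall m : R, 0 < m -> variance_fun mu m = m `^ p / lambda `^ (p - 1)) /\
  (exists mu_star : borel_measure R, dual_measure mu mu_star) /\
  (forall mu_star : borel_measure R, dual_measure mu mu_star ->
     mean_dom mu_star = `]0, +oo[%classic /\
     forall s : R, 0 < s ->
       variance_fun mu_star s = (p / q) `^ q * (1 / lambda) * s `^ q).
Proof.
have [r pE] : exists r, p = 1 + r by exists (p - 1); ring.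
subst p.
have e1 : 1 + r - 1 = r by ring.
have e2 : 2 - (1 + r) = 1 - r by ring.
rewrite e1 e2 in beta_def mu_log *.
have r0 : 0 < r by lra.
have r1 : 0 < 1 - r by lra.
have rn0 : r != 0 by rewrite gt_eqF.
have r1n0 : 1 - r != 0 by rewrite gt_eqF.
have pn0 : 1 + r != 0 by rewrite gt_eqF// addr_gt0.
have qE : q = 1 + r^-1.
  have qV : q^-1 = r / (1 + r).
    by move: conj_pq; rewrite !div1r => /(canRL (addKr _)) ->; field.
  by rewrite -(invrK q) qV; field; rewrite rn0.
have pqE : (1 + r) / q = r by rewrite qE; field; rewrite rn0 addrC.
(* Differentiating log_laplace mu brings out a factor beta, and
   lambda * (r `^ (- beta) / (1 - r)) * beta = A because beta + 1 = r^-1. *)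
pose A := lambda * r `^ (- r^-1).
have A0 : 0 < A by rewrite mulr_gt0// powR_gt0.
have rV0 : 0 < r^-1 by rewrite invr_gt0.
have mean s : 0 < s -> nef_mean mu s = A * s `^ (- r^-1).
  move=> s0; rewrite /nef_mean.
  rewrite (@derive1_power _ _ (lambda * (r `^ (- beta) / (1 - r))) (- beta))//; last first.
    by move=> t t0; rewrite mu_log// div1r -[(t `^ _)^-1]powRN.
  have -> : - beta - 1 = - r^-1 by rewrite beta_def; field.
  have -> : r `^ (- beta) = r * r `^ (- r^-1).
    rewrite -{2}(powRr1 (ltW r0)) -powRD ?rn0 ?implybT//; congr powR.
    by rewrite beta_def; field.
  by rewrite /A beta_def; field; rewrite rn0.
have [mean_mu var_mu] := power_mean_variance A0 rV0 mu_dom mean.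
pose A' := A `^ r.
have A'0 : 0 < A' by rewrite powR_gt0.
have A'E : A' = lambda `^ r / r.
  rewrite /A' powRM ?powR_ge0 ?ltW// -powRrM mulNr mulVf// powRN powRr1//.
  exact: ltW.
(* The inverse of the mean map of mu, which is the mean of every dual. *)
have meanK m : 0 < m -> exists2 s, 0 < s & nef_mean mu s = m /\ s = A' * m `^ (- r).
  move=> m0; exists (A `^ r^-1^-1 * m `^ (- r^-1^-1)).
    by rewrite mulr_gt0 ?powR_gt0.
  rewrite mean; last by rewrite mulr_gt0 ?powR_gt0.
  by rewrite power_inverseK// /A' invrK.
split; last split.
- split => // m m0; rewrite var_mu// invrK.
  rewrite powRN -/A' A'E invf_div; field.
  by rewrite rn0 gt_eqF// powR_gt0.
- pose a := 1 - r; pose k := A' / a.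
  have a01 : 0 < a < 1 by rewrite /a; lra.
  have k0 : 0 < k by rewrite divr_gt0.
  have [P PL] := exists_stable_measure a01 k0.
  have P_dom : `]0, +oo[%classic `<=` laplace_dom P.
    by apply: pos_subset_interior => s s0; rewrite /= PL// ltry.
  exists P; split.
  + split; first exact: stable_not_concentrated k0 a01 PL.
    by exists 1; apply: P_dom; rewrite /= in_itv/= ltr01.
  + by rewrite mean_mu.
  + move=> s; rewrite mu_dom/= in_itv/= andbT => s0.
    have m0 : 0 < nef_mean mu s by rewrite mean// mulr_gt0// powR_gt0.
    rewrite {1}/nef_mean (@derive1_power _ _ (- k) a)//; last first.
      by move=> t t0; rewrite /log_laplace PL//= expRK mulNr.
    have [t t0 [tm tE]] := meanK _ m0.
    have st : s = t.
      rewrite (power_inverse A0 rV0 s0 m0 (esym (mean s s0))).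
      have tm' : A * t `^ (- r^-1) = nef_mean mu s by rewrite -tm (mean t t0).
      by rewrite [RHS](power_inverse A0 rV0 t0 m0 tm').
    rewrite {2}st tE /a (_ : 1 - r - 1 = - r); last by ring.
    by rewrite /k /a; field.
- move=> nu [[nu_nc nu_ne] nu_dom nu_dual].
  have nu_mean m : 0 < m -> nef_mean nu m = A' * m `^ (- r).
    move=> /meanK[s s0 [sm <-]]; rewrite -sm nu_dual// mu_dom.
    by rewrite /= in_itv/= s0.
  have nuT : (nu setT != 0)%E.
    apply/eqP => nu0; apply: nu_nc; exists 0; apply/eqP.
    by rewrite -measure_le0 -nu0 le_measure ?inE//; exact: measurableC.
  have nu_domE : laplace_dom nu = `]0, +oo[%classic.
    apply: (power_mean_laplace_dom A'0 r0) => //.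
    by rewrite -mean_mu.
  have [mean_nu var_nu] := power_mean_variance A'0 r0 nu_domE nu_mean.
  split => // s s0; rewrite var_nu// -qE pqE.
  congr (_ * _); rewrite /A' -powRrM mulrN divff// powRN powRr1 ?ltW//.
  rewrite /A invfM -powRN opprK qE.
  by rewrite [in RHS]powRD ?rn0 ?implybT// powRr1 ?ltW// div1r; ring.
Qed.
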